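(* Let $k$ be a field, $A=k[x_1,\ldots,x_d]$ the polynomial Hopf algebra, and let $q:A\to A\otimes A$ and $I:A\to A\otimes A$ be two linear maps. Then $$I(a)=\sum(-1)^{|a_2|}q(a_1)\Delta(a_2)\quad\text{for all } a\in A$$ if and only if $$q(a)=\sum I(a_1)\Delta(a_2)\quad\text{for all } a\in A.$$
   Context: $A=k[x_1,\ldots,x_d]$ is the Hopf algebra (the universal enveloping algebra of the $d$-dimensional abelian Lie algebra) whose comultiplication $\Delta$ is the algebra map with $\Delta(x_i)=x_i\otimes 1+1\otimes x_i$. Sweedler notation: $\Delta(a)=\sum a_1\otimes a_2$. For a monic monomial $a$, $|a|$ is its degree and $\Delta(a)=\sum a_1\otimes a_2$ is expanded in the monomial basis; signs $(-1)^{|a_2|}$ are computed in this expansion and expressions are extended linearly to all $a\in A$. Products such as $q(a_1)\Delta(a_2)$ are taken in the algebra $A\otimes A$. *)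

(* Defs.v *)
From HB Require Import structures.
From mathcomp Require Import all_boot all_order all_algebra.
From mathcomp Require Import ssrcomplements.
From mathcomp Require Export mpoly.

Set Implicit Arguments.
Unset Strict Implicit.
Unset Printing Implicit Defensive.

Import GRing.Theory.
Local Open Scope ring_scope.

(* The algebra A (x) A, for A = {mpoly k[d]}, is realized as the polynomial
   algebra in d + d variables: 'X_(lshift d i) stands for x_i (x) 1 and
   'X_(rshift d i) for 1 (x) x_i. Lemmas [tensorDl]-[tensorM] and
   [tensor_universal] show that [tensor] makes it the tensor product
   algebra. *)
Notation "{ 'tensor' k [ d ] }" := {mpoly k[d + d]}
  (k at level 2, d at level 50, format "{ 'tensor'  k [ d ] }") : type_scope.

Section Definitions.

Variables (k : fieldType) (d : nat).
Implicit Types a b : {mpoly k[d]}.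

Definition tensor a b : {tensor k[d]} :=
  (a \mPo [tuple 'X_(lshift d i) | i < d]) *
  (b \mPo [tuple 'X_(rshift d i) | i < d]).

Definition mfst (m : 'X_{1..d + d}) : 'X_{1..d} :=
  [multinom m (lshift d i) | i < d].
Definition msnd (m : 'X_{1..d + d}) : 'X_{1..d} :=
  [multinom m (rshift d i) | i < d].

(* Sum of c * F(m1, m2) over the expansion of t as a linear combination of the
   tensors c . m1 (x) m2 of monomials (see [tensor_expand]). *)
Definition tensor_sum (V : lmodType k) (F : 'X_{1..d} -> 'X_{1..d} -> V)
    (t : {tensor k[d]}) : V :=
  \sum_(m <- msupp t) t@_m *: F (mfst m) (msnd m).

Definition Delta a : {tensor k[d]} :=
  a \mPo [tuple tensor 'X_i 1 + tensor 1 'X_i | i < d].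

(* Sweedler's sum of F(a_1, a_2), where a_1 and a_2 run over the monomials in
   the expansion of Delta a. *)
Definition sweedler (V : lmodType k) (F : 'X_{1..d} -> 'X_{1..d} -> V) a : V :=
  tensor_sum F (Delta a).

End Definitions.

Section TensorTheory.

Variables (k : fieldType) (d : nat).
Implicit Types (a b : {mpoly k[d]}) (t : {tensor k[d]}).

Lemma tensorDl a a' b : tensor (a + a') b = tensor a b + tensor a' b.
Proof. by rewrite /tensor linearD mulrDl. Qed.

Lemma tensorDr a b b' : tensor a (b + b') = tensor a b + tensor a b'.
Proof. by rewrite /tensor linearD mulrDr. Qed.

Lemma tensorZl c a b : tensor (c *: a) b = c *: tensor a b.
Proof. by rewrite /tensor linearZ scalerAl. Qed.

Lemma tensorZr c a b : tensor a (c *: b) = c *: tensor a b.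
Proof. by rewrite /tensor linearZ scalerAr. Qed.

Lemma tensor11 : tensor 1 1 = 1 :> {tensor k[d]}.
Proof. by rewrite /tensor !rmorph1 mulr1. Qed.

Lemma tensorM a b a' b' :
  tensor (a * a') (b * b') = tensor a b * tensor a' b'.
Proof. by rewrite /tensor !rmorphM mulrACA. Qed.

Lemma tensorX (m : 'X_{1..d + d}) :
  tensor 'X_[mfst m] 'X_[msnd m] = 'X_[m] :> {tensor k[d]}.
Proof.
rewrite /tensor !comp_mpolyX [RHS]mpolyXE_id big_split_ord /=.
by congr (_ * _); apply: eq_bigr => i _; rewrite tnth_mktuple mnmE.
Qed.

Lemma tensor_expand t :
  t = tensor_sum (fun m1 m2 => tensor 'X_[m1] 'X_[m2]) t.
Proof.
rewrite [LHS]mpolyE; apply: eq_bigr => m _.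
by rewrite tensorX.
Qed.

Lemma tensor_sumE (V : lmodType k) (F : 'X_{1..d} -> 'X_{1..d} -> V) t w :
  (msize t <= w)%N ->
  tensor_sum F t
    = \sum_(m : bmultinom (d + d) w) t@_m *: F (mfst m) (msnd m).
Proof.
move=> tw; set T : subFinType _ := bmultinom (d + d) w.
rewrite /tensor_sum (big_mksub T) ?msupp_uniq //=; first last.
  by move=> m /msize_mdeg_lt /leq_trans; apply.
by rewrite big_rmcond //= => m /memN_msupp_eq0 ->; rewrite scale0r.
Qed.

Lemma tensor_sum_is_linear (V : lmodType k)
  (F : 'X_{1..d} -> 'X_{1..d} -> V) : linear (tensor_sum F).
Proof.
move=> c t u.
pose w := maxn (msize (c *: t + u)) (maxn (msize t) (msize u)).
rewrite !(@tensor_sumE _ _ _ w) ?leq_max ?leqnn ?orbT //.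
rewrite scaler_sumr -big_split /=; apply: eq_bigr => m _.
by rewrite mcoeffD mcoeffZ scalerDl scalerA.
Qed.

Lemma tensor_sumX (V : lmodType k) (F : 'X_{1..d} -> 'X_{1..d} -> V) m1 m2 :
  tensor_sum F (tensor 'X_[m1] 'X_[m2]) = F m1 m2.
Proof.
pose m : 'X_{1..d + d} :=
  [multinom match split i with inl j => m1 j | inr j => m2 j end | i < d + d].
have E1 : mfst m = m1.
  by apply/mnmP => i; rewrite !mnmE (unsplitK (inl _ i)).
have E2 : msnd m = m2.
  by apply/mnmP => i; rewrite !mnmE (unsplitK (inr _ i)).
rewrite -{1}E1 -{1}E2 tensorX /tensor_sum msuppX big_seq1.
by rewrite mcoeffX eqxx scale1r E1 E2.
Qed.

Lemma tensor_universal (V : lmodType k)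
    (B : {mpoly k[d]} -> {mpoly k[d]} -> V) :
    (forall b, linear (B^~ b)) -> (forall a, linear (B a)) ->
  exists f : {linear {tensor k[d]} -> V},
    (forall a b, f (tensor a b) = B a b) /\
    (forall g : {linear {tensor k[d]} -> V},
       (forall a b, g (tensor a b) = B a b) -> g =1 f).
Proof.
move=> Bl Br.
pose f0 := tensor_sum (fun m1 m2 => B 'X_[m1] 'X_[m2]).
pose fM := GRing.isLinear.Build k _ V *:%R f0 (tensor_sum_is_linear _).
pose f : {linear {tensor k[d]} -> V} := HB.pack f0 fM.
have linE (W : lmodType k) (h h' : {mpoly k[d]} -> W) :
    linear h -> linear h' -> (forall m, h 'X_[m] = h' 'X_[m]) -> h =1 h'.
  move=> hL hL' hh' a.
  pose hM := GRing.isLinear.Build k _ W *:%R h hL.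
  pose hM' := GRing.isLinear.Build k _ W *:%R h' hL'.
  pose H : {linear {mpoly k[d]} -> W} := HB.pack h hM.
  pose H' : {linear {mpoly k[d]} -> W} := HB.pack h' hM'.
  rewrite -[h a]/(H a) -[h' a]/(H' a) [a]mpolyE !linear_sum.
  by apply: eq_bigr => m _; rewrite !linearZ /= hh'.
exists f; split=> [a b | g gB t].
  apply: (linE V (fun a => f (tensor a b)) (B^~ b)) => //.
    by move=> c x y; rewrite tensorDl tensorZl linearP.
  move=> m1; apply: (linE V (fun b => f (tensor 'X_[m1] b)) (B 'X_[m1])) => //.
    by move=> c x y; rewrite tensorDr tensorZr linearP.
  by move=> m2; apply: tensor_sumX.
rewrite {1}[t]tensor_expand linear_sum; apply: eq_bigr => m _.
by rewrite linearZ /= gB.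
Qed.

Lemma DeltaXU i : Delta 'X_i = tensor 'X_i 1 + tensor 1 'X_i :> {tensor k[d]}.
Proof. by rewrite /Delta comp_mpolyXU -tnth_nth tnth_mktuple. Qed.

End TensorTheory.

(* Main.v *)
Require Import Defs.
From HB Require Import structures.
From mathcomp Require Import all_boot all_order all_algebra ssrcomplements.

Import GRing.Theory.
Local Open Scope ring_scope.

(** Write R = A (x) A. Both sums have the form f * chi : a |-> sum f(a_1) chi(a_2),
    where chi : A -> R is an algebra map: chi = Delta in one case, and in the
    other chi = Delta o S with S the antipode, S(m) = (-1)^|m| m on monomials.
    An algebra map is determined by its values c_i = chi(x_i), and those of
    Delta o S are the opposites of those of Delta.

    Let f_R : R[X_1, ..., X_d] -> R be the R-linear extension of f. Since
    Delta(a) is a evaluated at x_i (x) 1 + 1 (x) x_i, one has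
      (f * chi)(a) = f_R (a(X_1 + c_1, ..., X_d + c_d))   [convE]
    and hence, by R-linearity,
      (f * chi)_R (p) = f_R (p(X_1 + c_1, ..., X_d + c_d))  for p in R[X].
    Thus convolution with chi is dual to the translation by c. As the
    translations by c and by - c are inverse to each other, so are the
    convolutions with Delta and with Delta o S [convNK], which is the claimed
    equivalence. Only the commutativity of the k-algebra R matters here. *)

Section Convolution.

Context {k : fieldType} {d : nat} {R : comAlgType k}.
Implicit Types (f g : {mpoly k[d]} -> R) (c : 'I_d -> R).
Implicit Types (a : {mpoly k[d]}) (p : {mpoly R[d]}).

(** The polynomial a(X + c), as a polynomial with coefficients in R. *)
Definition shift c a : {mpoly R[d]} :=
  mmap (@mpolyC d R \o in_alg R) (fun i => 'X_i + (c i)%:MP) a.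

(** The translation p(X) |-> p(X + c) of R[X]. *)
Definition translate c p : {mpoly R[d]} :=
  p \mPo [tuple 'X_i + (c i)%:MP | i < d].

(** The R-linear extension of f to R[X], which maps the monomial X^m to
    f(x^m). *)
Definition base_ext f p : R := \sum_(m <- msupp p) p@_m * f 'X_[m].

(** The convolution of f with the algebra map that sends x_i to c i. *)
Definition conv c f a : R :=
  sweedler (fun m1 m2 => f 'X_[m1] * mmap1 c m2) a.

Lemma base_extE f p w : (msize p <= w)%N ->
  base_ext f p = \sum_(m : bmultinom d w) p@_m * f 'X_[m].
Proof.
move=> pw; set T : subFinType _ := bmultinom d w.
rewrite /base_ext (big_mksub T) ?msupp_uniq //=; first last.
  by move=> m /msize_mdeg_lt /leq_trans; apply.
by rewrite big_rmcond //= => m /memN_msupp_eq0 ->; rewrite mul0r.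
Qed.

Lemma base_ext_is_linear f : linear_for *%R (base_ext f).
Proof.
move=> x p p'.
pose w := maxn (msize (x *: p + p')) (maxn (msize p) (msize p')).
rewrite !(base_extE _ _ w) ?leq_max ?leqnn ?orbT //.
rewrite mulr_sumr -big_split /=; apply: eq_bigr => m _.
by rewrite mcoeffD mcoeffZ mulrDl mulrA.
Qed.

HB.instance Definition _ f :=
  GRing.isLinear.Build R {mpoly R[d]} R *%R (base_ext f) (base_ext_is_linear f).

Lemma base_extX f m : base_ext f 'X_[m] = f 'X_[m].
Proof. by rewrite /base_ext msuppX big_seq1 mcoeffX eqxx mul1r. Qed.

Lemma shiftE c a :
  shift c a = \sum_(m <- msupp a) (a@_m)%:A *: shift c 'X_[m].
Proof.
by apply: eq_bigr => m _; rewrite [shift _ _]mmapX mul_mpolyC.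
Qed.

Lemma translate_shift c c' a :
  translate c (shift c' a) = shift (fun i => c i + c' i) a.
Proof.
rewrite [in LHS]shiftE [RHS]shiftE /translate linear_sum.
apply: eq_bigr => m _; rewrite linearZ /= /shift !mmapX rmorph_prod /=.
congr (_ *: _); apply: eq_bigr => i _.
rewrite rmorphXn rmorphD /= comp_mpolyC comp_mpolyXU -tnth_nth tnth_mktuple.
by rewrite mpolyCD addrA.
Qed.

Lemma base_ext_shift0 (f : {linear {mpoly k[d]} -> R}) c a :
  c =1 (fun=> 0) -> base_ext f (shift c a) = f a.
Proof.
move=> c0; rewrite shiftE [in RHS](mpolyE a) !linear_sum.
apply: eq_bigr => m _; rewrite linearZ /= [RHS]linearZ /=.
have -> : shift c 'X_[m] = 'X_[m].
  rewrite /shift mmapX -[RHS]mmap1_id; apply: mmap1_eq => i.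
  by rewrite c0 mpolyC0 addr0.
by rewrite base_extX mulr_algl.
Qed.

Lemma convE c f a : conv c f a = base_ext f (shift c a).
Proof.
(* theta : A (x) A -> R[X] sends x_i (x) 1 to X_i and 1 (x) x_i to c_i. *)
pose h (i : 'I_(d + d)) : {mpoly R[d]} :=
  match split i with inl j => 'X_j | inr j => (c j)%:MP end.
pose theta := mmap (@mpolyC d R \o in_alg R) h.
have hl i : h (lshift d i) = 'X_i by rewrite /h (unsplitK (inl _ i)).
have hr i : h (rshift d i) = (c i)%:MP by rewrite /h (unsplitK (inr _ i)).
have thetaX m : mmap1 h m = mmap1 c (msnd m) *: 'X_[mfst m].
  rewrite /mmap1 big_split_ord /= -mul_mpolyC mulrC [in RHS]mpolyXE_id.
  rewrite rmorph_prod; congr (_ * _); apply: eq_bigr => i _.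
    by rewrite hr mnmE rmorphXn.
  by rewrite hl mnmE.
have -> : shift c a = theta (Delta a).
  rewrite /Delta comp_mpolyE /theta raddf_sum; apply: eq_bigr => m _.
  rewrite /= mmapZ rmorph_prod; congr (_ * _); apply: eq_bigr => i _.
  rewrite tnth_mktuple rmorphXn rmorphD /= /tensor !rmorph1 mul1r mulr1.
  by rewrite !comp_mpolyXU -!tnth_nth !tnth_mktuple !mmapX !mmap1U hl hr.
rewrite /theta linear_sum; apply: eq_bigr => m _.
rewrite thetaX mul_mpolyC !linearZ /= base_extX mulr_algl.
by rewrite (mulrC (f _)).
Qed.

(** Convolution is dual to translation: (f * chi)_R = f_R o translate c. *)
Lemma base_ext_conv c f g p :
  g =1 conv c f -> base_ext g p = base_ext f (translate c p).
Proof.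
move=> gE; rewrite /translate comp_mpolyE linear_sum.
apply: eq_bigr => m _; rewrite linearZ /= gE convE /shift mmapX.
by congr (_ * base_ext f _); apply: eq_bigr => i _; rewrite tnth_mktuple.
Qed.

Lemma convNK c c' (f : {linear {mpoly k[d]} -> R}) g :
  (forall i, c i + c' i = 0) -> g =1 conv c f -> f =1 conv c' g.
Proof.
move=> cc' gE a.
by rewrite convE (base_ext_conv c f) // translate_shift base_ext_shift0.
Qed.

Lemma mmap1N c m : mmap1 (fun i => - c i) m = (-1) ^+ mdeg m * mmap1 c m.
Proof.
rewrite /mmap1 mdegE -prodrXr -big_split /=.
by apply: eq_bigr => i _; rewrite [LHS]exprNn.
Qed.

End Convolution.

Theorem proposition4p3 (k : fieldType) (d : nat)
    (q I : {linear {mpoly k[d]} -> {tensor k[d]}}) :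
  (forall a : {mpoly k[d]},
     I a = sweedler
             (fun a1 a2 : 'X_{1..d} =>
                (-1) ^+ mdeg a2 *: (q 'X_[a1] * Delta 'X_[a2])) a)
  <->
  (forall a : {mpoly k[d]},
     q a = sweedler
             (fun a1 a2 : 'X_{1..d} => I 'X_[a1] * Delta 'X_[a2]) a).
Proof.
pose c (i : 'I_d) : {tensor k[d]} := Delta 'X_i.
have DeltaX m : Delta 'X_[m] = mmap1 c m.
  rewrite [LHS]mmapX; apply: mmap1_eq => i.
  by rewrite /c DeltaXU tnth_mktuple.
have convD f a : sweedler (fun a1 a2 => f 'X_[a1] * Delta 'X_[a2]) a
    = conv c f a.
  by apply: eq_bigr => m _; rewrite DeltaX.
have convS f a : sweedler (fun a1 a2 =>
    (-1) ^+ mdeg a2 *: (f 'X_[a1] * Delta 'X_[a2])) a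
    = conv (fun i => - c i) f a.
  apply: eq_bigr => m _; congr (_ *: _).
  rewrite DeltaX mmap1N mulrCA -[in LHS]signr_odd -[in RHS]signr_odd.
  by rewrite scaler_sign mulr_sign.
split=> E a.
- rewrite convD; apply: (convNK (fun i => - c i) c) => [i | b].
    exact: addNr.
  by rewrite E convS.
- rewrite convS; apply: (convNK c (fun i => - c i)) => [i | b]; first exact: addrN.
  by rewrite E convD.
Qed.
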